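(* Let $\Gamma=\mathbb{Z}_{m_1}\oplus\cdots\oplus\mathbb{Z}_{m_r}$ with integers $m_i\ge 1$, and let $G=\operatorname{Cay}(\Gamma,S)$ be a gcd-graph over $\Gamma$. Let $D$ be a set of nonnegative integers, possibly also including $\infty$, i.e. $D\subseteq\{0,1,2,\ldots\}\cup\{\infty\}$. Then the distance power $G^D$ is also a gcd-graph over $\Gamma=\mathbb{Z}_{m_1}\oplus\cdots\oplus\mathbb{Z}_{m_r}$.
   Context: $\mathbb{Z}_{m}$ denotes the additive group of integers modulo $m$, with elements identified with $\{0,1,\ldots,m-1\}$; elements of $\Gamma=\mathbb{Z}_{m_1}\oplus\cdots\oplus\mathbb{Z}_{m_r}$ are $r$-tuples $x=(x_1,\ldots,x_r)$ with $x_i\in\mathbb{Z}_{m_i}$. Put $m=(m_1,\ldots,m_r)$ and $\gcd(x,m)=(\gcd(x_1,m_1),\ldots,\gcd(x_r,m_r))$, with the convention $\gcd(0,m_i)=m_i$. A divisor tuple of $m$ is a tuple $d=(d_1,\ldots,d_r)$ with $d_i\ge 1$ and $d_i\mid m_i$ for all $i$. For each divisor tuple $d$ the elementary gcd-set is $S_\Gamma(d)=\{x\in\Gamma:\gcd(x,m)=d\}$. A gcd-set of $\Gamma$ is a union of elementary gcd-sets (the empty set is allowed). For $S\subseteq\Gamma$ with $-S=S$, the undirected Cayley graph $\operatorname{Cay}(\Gamma,S)$ has vertex set $\Gamma$, and $a,b\in\Gamma$ are adjacent iff $a-b\in S$ ($0\in S$ is allowed and produces a loop at every vertex). A gcd-graph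 over $\Gamma$ (with respect to the given direct sum decomposition) is a graph $\operatorname{Cay}(\Gamma,S)$ where $S$ is a gcd-set of $\Gamma$ (gcd-sets automatically satisfy $-S=S$). For an undirected graph $G=(V,E)$, $d(x,y)$ denotes the usual graph distance, with $d(x,x)=0$ and $d(x,y)=\infty$ if $x,y$ lie in different connected components. The distance power $G^D$ is the undirected graph with vertex set $V$ in which $x,y$ are adjacent if and only if $d(x,y)\in D$ (so $0\in D$ gives a loop at every vertex). *)

(* Defs.v *)
From HB Require Import structures.
From mathcomp Require Import all_boot all_algebra.
From mathcomp Require Import boolp classical_sets.

Set Implicit Arguments.
Unset Strict Implicit.
Unset Printing Implicit Defensive.

Import GRing.Theory.
Local Open Scope ring_scope.

(* Z_(m_1) (+) ... (+) Z_(m_r). For m_i >= 1 the type 'I_(m_i).-1.+1 is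
   'I_(m_i), with its addition modulo m_i; unlike 'Z_(m_i) it is the trivial
   group for m_i = 1. *)
Definition Gamma (r : nat) (m : 'I_r -> nat) : predArgType :=
  {dffun forall i : 'I_r, 'I_(m i).-1.+1}.

HB.instance Definition _ r (m : 'I_r -> nat) := Finite.on (Gamma m).

Section GammaZmodule.
Variables (r : nat) (m : 'I_r -> nat).
Implicit Types x y : Gamma m.

Definition Gamma_zero : Gamma m := [ffun i => 0].
Definition Gamma_opp x : Gamma m := [ffun i => - x i].
Definition Gamma_add x y : Gamma m := [ffun i => x i + y i].

Lemma Gamma_addA : associative Gamma_add.
Proof. by move=> x y z; apply/ffunP => i; rewrite !ffunE addrA. Qed.

Lemma Gamma_addC : commutative Gamma_add.
Proof. by move=> x y; apply/ffunP => i; rewrite !ffunE addrC. Qed.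

Lemma Gamma_add0 : left_id Gamma_zero Gamma_add.
Proof. by move=> x; apply/ffunP => i; rewrite !ffunE add0r. Qed.

Lemma Gamma_addN : left_inverse Gamma_zero Gamma_opp Gamma_add.
Proof. by move=> x; apply/ffunP => i; rewrite !ffunE addNr. Qed.

HB.instance Definition _ := GRing.isZmodule.Build (Gamma m)
  Gamma_addA Gamma_addC Gamma_add0 Gamma_addN.
End GammaZmodule.

(* Loops are allowed: no irreflexivity is required. *)
Record ugraph (V : finType) := UGraph {
  adj :> rel V;
  adj_sym : symmetric adj
}.

Section Distance.
Variables (V : finType) (G : ugraph V).

Definition walk (n : nat) (x y : V) : bool :=
  [exists p : n.-tuple V, path G x p && (last x p == y)].

Lemma connect_walk x y : connect G x y -> exists n, walk n x y.
Proof.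
case/connectP => p Gp ->; exists (size p); apply/existsP.
by exists (in_tuple p); rewrite /= Gp eqxx.
Qed.

(* None stands for infinity. *)
Definition dist (x y : V) : option nat :=
  match @idP (connect G x y) with
  | ReflectT Gxy => Some (ex_minn (connect_walk Gxy))
  | ReflectF _ => None
  end.

Lemma walk_sym n x y : walk n x y = walk n y x.
Proof.
suff sub u v : walk n u v -> walk n v u by apply/idP/idP; apply: sub.
case/existsP => p /andP[Gp /eqP <-]; apply/existsP.
have szq : size (rev (belast u p)) == n by rewrite size_rev size_belast size_tuple.
exists (Tuple szq); apply/andP; split => /=.
  rewrite rev_path; rewrite -(eq_path (e := G)) // => a b.
  exact: adj_sym.
case: (p : seq V) => [|a s] //=.
by rewrite rev_cons last_rcons.
Qed.

Lemma dist_sym x y : dist x y = dist y x.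
Proof.
have csym : connect G x y = connect G y x.
  exact: (sym_connect_sym (@adj_sym _ G)).
rewrite /dist.
case: {-}_ / idP => [Gxy|nGxy]; case: {-}_ / idP => [Gyx|nGyx] //.
- congr Some; case: ex_minnP => a wa mina; case: ex_minnP => b wb minb.
  by apply/eqP; rewrite eqn_leq mina ?minb // walk_sym.
- by case: nGyx; rewrite -csym.
- by case: nGxy; rewrite csym.
Qed.
End Distance.

Definition distance_power (V : finType) (G : ugraph V)
    (D : set (option nat)) : ugraph V :=
  @UGraph V (fun x y => dist G x y \in D)
    (fun x y => congr1 (fun k => k \in D) (dist_sym G x y)).

Lemma cayley_sym (A : finZmodType) (S : {set A}) :
  [set - x | x in S] = S -> symmetric (fun a b : A => a - b \in S).
Proof.
move=> NS a b; rewrite -opprB -{1}NS.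
by apply/imsetP/idP => [[x xS /oppr_inj ->] | abS] //; exists (b - a).
Qed.

Definition Cay (A : finZmodType) (S : {set A})
    (NS : [set - x | x in S] = S) : ugraph A :=
  UGraph (cayley_sym NS).

Section GcdGraph.
Variables (r : nat) (m : 'I_r -> nat).

Definition divisor_tuple (d : {ffun 'I_r -> nat}) : bool :=
  [forall i, (0 < d i)%N && (d i %| m i)%N].

(* gcdn 0 n = n, in accordance with the convention gcd(0, m_i) = m_i. *)
Definition elem_gcd_set (d : {ffun 'I_r -> nat}) : {set Gamma m} :=
  [set x : Gamma m | [forall i, gcdn (x i) (m i) == d i]].

(* There are only finitely many divisor tuples, so finite unions suffice; the
   empty list gives the empty gcd-set. *)
Definition gcd_set (S : {set Gamma m}) : Prop :=
  exists2 ds : seq {ffun 'I_r -> nat},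
    all divisor_tuple ds & S = (\bigcup_(d <- ds) elem_gcd_set d)%SET.

Lemma gcdn_oppr n (a : 'I_n.-1.+1) : gcdn (- a : 'I_n.-1.+1) n = gcdn a n.
Proof.
case: n a => [|n] a; first by rewrite (ord1 a) (ord1 (- _)).
rewrite /= gcdn_modl; have le_an : (a <= n.+1)%N := ltnW (ltn_ord a).
have := gcdnDr a (n.+1 - a); have := gcdnDl (n.+1 - a) a.
by rewrite subnK // => -> ->; rewrite gcdnC.
Qed.

Lemma gcd_setN S : gcd_set S -> [set - x | x in S] = S.
Proof.
case=> ds _ ->; have sub x : x \in (\bigcup_(d <- ds) elem_gcd_set d)%SET ->
    - x \in (\bigcup_(d <- ds) elem_gcd_set d)%SET.
  elim: ds => [|d ds IHds]; first by rewrite big_nil inE.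
  rewrite big_cons !inE => /orP[/forallP xd | /IHds ->]; last by rewrite orbT.
  by apply/orP; left; apply/forallP => i; rewrite ffunE gcdn_oppr.
apply/setP => x; apply/imsetP/idP => [[y yS ->] | xS]; first exact: sub.
by exists (- x); rewrite ?opprK //; exact: sub.
Qed.

(* G =2 H says that G and H have the same edges. *)
Definition gcd_graph (G : ugraph (Gamma m)) : Prop :=
  exists S (gS : gcd_set S), G =2 Cay (gcd_setN gS).
End GcdGraph.

(* Main.v *)
Require Import Defs.
From mathcomp Require Import all_boot all_algebra.
From mathcomp Require Import cyclic.
From mathcomp Require Import boolp classical_sets.

(** Distances in a Cayley graph are translation invariant, so the distance power
    is again a Cayley graph, with connection set the x such that d(x, 0) \in D.
    It remains to see why this set is a union of elementary gcd-sets, in other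
    words why d(x, 0) depends only on gcd(x, m).

    If gcd(x, m) = gcd(y, m), then y is obtained from x by multiplying each
    coordinate x_i by some u_i prime to m_i ([coprime_multiplier]).
    Such a coordinatewise multiplication is additive, fixes 0 and does not
    change gcds, so it preserves the gcd-set S and is an endomorphism of the
    graph: it maps walks from x to 0 to walks of the same length from y to 0.
    Exchanging x and y gives the converse, and walk lengths determine the
    distance ([eq_dist]). *)

Set Implicit Arguments.
Unset Strict Implicit.
Unset Printing Implicit Defensive.

Import GRing.Theory.

(** Units lift along Z_n -> Z_d for d %| n: the class v + dZ contains an integer
    prime to n. Take k to be the part of n prime to v. A prime factor of n
    then divides exactly one of v and k * d, hence not their sum. *)
Lemma coprime_lift (v d n : nat) :
    0 < v -> 0 < n -> coprime v d ->
  exists k, coprime (v + k * d) n.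
Proof.
move=> v_gt0 n_gt0 co_vd; exists n`_(\pi(v)^').
rewrite /coprime eqn_leq gcdn_gt0 n_gt0 orbT andbT leqNgt; apply/negP.
move/pdiv_prime; move: (pdiv_dvd (gcdn (v + n`_(\pi(v)^') * d) n)).
set p := pdiv _; rewrite dvdn_gcd => /andP[p_sum p_n] p_pr.
have p_k : (p %| n`_(\pi(v)^')) = ~~ (p %| v).
  have := pi_of_part (\pi(v)^') n_gt0 p.
  by rewrite !inE /= !mem_primes p_pr part_gt0 n_gt0 v_gt0 p_n.
have [p_v | p_nv] := boolP (p %| v); last first.
  by rewrite dvdn_addl ?(negPf p_nv) // dvdn_mulr ?p_k in p_sum.
move: p_sum; rewrite dvdn_addr // Euclid_dvdM // p_k p_v /= => p_d.
have : (p %| gcdn v d) by rewrite dvdn_gcd p_v.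
by rewrite (eqP co_vd) Euclid_dvd1.
Qed.

(** Two residues with the same gcd with n are associated in Z_n. After division
    by the common gcd both become units modulo n' = n / gcd; their quotient,
    which exists by Euler's theorem, is then lifted to a unit modulo n. *)
Lemma coprime_multiplier (a b n : nat) :
    0 < n -> gcdn a n = gcdn b n ->
  exists2 u, coprime u n & a * u = b %[mod n].
Proof.
move=> n_gt0 eq_ab; set g := gcdn a n.
have g_gt0 : (0 < g) by rewrite gcdn_gt0 n_gt0 orbT.
have /dvdnP[a' def_a] : (g %| a) by apply: dvdn_gcdl.
have /dvdnP[b' def_b] : (g %| b) by rewrite /g eq_ab dvdn_gcdl.
have /dvdnP[n' def_n] : (g %| n) by apply: dvdn_gcdr.
have n'_gt0 : (0 < n') by move: n_gt0; rewrite def_n muln_gt0 => /andP[].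
have co_a : coprime a' n'.
  by rewrite /coprime -(eqn_pmul2r g_gt0) mul1n muln_gcdl -def_a -def_n.
have co_b : coprime b' n'.
  by rewrite /coprime -(eqn_pmul2r g_gt0) mul1n muln_gcdl -def_b -def_n -eq_ab.
(* Adding n' keeps v in its class modulo n' and makes it positive: for n' = 1
   and b' = 0 the first summand may vanish. *)
pose v := (a' ^ (totient n').-1 * b' + n').
have v_gt0 : (0 < v) by rewrite addn_gt0 n'_gt0 orbT.
have co_v : coprime v n'.
  by rewrite /coprime gcdnC gcdnDr gcdnC -/(coprime _ _) coprimeMl coprimeXl.
have [k co_w] := coprime_lift v_gt0 n_gt0 co_v.
exists (v + k * n') => //.
rewrite {1}def_a {1}def_b [in RHS]def_n def_n mulnAC -!muln_modl.
congr (_ * g); rewrite /v -addnA -mulSn mulnDr mulnA -expnS.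
rewrite prednK ?totient_gt0 // (mulnA a') addnC modnMDl.
by rewrite -modnMml Euler_exp_totient // modnMml mul1n.
Qed.

Section Walks.
Variables (V : finType) (G H : ugraph V).

Lemma walk_connect (K : ugraph V) n x y : walk K n x y -> connect K x y.
Proof.
by case/existsP => p /andP[Gp /eqP <-]; apply/connectP; exists (val p).
Qed.

Lemma walk_homo (f : V -> V) n x y :
  (forall a b, G a b -> H (f a) (f b)) -> walk G n x y -> walk H n (f x) (f y).
Proof.
move=> homo_f /existsP[p /andP[Gp /eqP <-]]; apply/existsP.
exists [tuple of map f p] => /=.
by rewrite (homo_path (e := G)) //= last_map eqxx.
Qed.

(** Walks of all lengths are compared, not just shortest ones: this also settles
    the infinite distance, which is the absence of walks. *)
Lemma eq_dist x y x' y' :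
  (forall n, walk G n x y = walk H n x' y') -> dist G x y = dist H x' y'.
Proof.
move=> eq_walk; have eq_connect : connect G x y = connect H x' y'.
  apply/idP/idP => /connect_walk[n]; first by rewrite eq_walk => /walk_connect.
  by rewrite -eq_walk => /walk_connect.
rewrite /dist; case: {-}_ / idP => [Gxy|nGxy]; case: {-}_ / idP => [Gxy'|nGxy'] //.
- congr Some; case: ex_minnP => a wa mina; case: ex_minnP => b wb minb.
  by apply/eqP; rewrite eqn_leq mina ?minb ?eq_walk // -eq_walk.
- by case: nGxy'; rewrite -eq_connect.
- by case: nGxy; rewrite eq_connect.
Qed.

End Walks.

Local Open Scope ring_scope.

(** Translations by b and by - b are graph endomorphisms; they exchange walks
    from a to b with walks from a - b to 0. *)
Lemma dist_Cay_sub (A : finZmodType) (S : {set A})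
    (NS : [set - x | x in S] = S) (a b : A) :
  dist (Cay NS) a b = dist (Cay NS) (a - b) 0.
Proof.
have homo_add c : {homo +%R^~ c : x y / Cay NS x y}.
  by move=> x y; rewrite /= opprD addrACA subrr addr0.
apply: eq_dist => n; apply/idP/idP => [/(walk_homo (homo_add (- b)))|].
  by rewrite /= subrr.
by move/(walk_homo (homo_add b)); rewrite /= subrK add0r.
Qed.

Lemma in_bigcup_seq (I : Type) (T : finType) (s : seq I) (F : I -> {set T}) x :
  (x \in (\bigcup_(i <- s) F i)%SET) = has (fun i => x \in F i) s.
Proof.
by elim: s => [|i s IHs]; rewrite ?big_nil ?inE // big_cons inE IHs.
Qed.

Section GcdSets.
Variables (r : nat) (m : 'I_r -> nat).
Hypothesis m_gt0 : forall i : 'I_r, (0 < m i)%N.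

Definition same_gcd (x y : Gamma m) : Prop :=
  forall i, gcdn (x i) (m i) = gcdn (y i) (m i).

(** The elementary gcd-sets are the classes of [same_gcd], so gcd-sets are the
    sets saturated for it. As every m_i is positive, the gcd tuples of the
    elements of a set are divisor tuples; they index the required union. *)
Lemma gcd_setP (S : {set Gamma m}) :
  gcd_set S <-> (forall x y, same_gcd x y -> x \in S -> y \in S).
Proof.
split=> [[ds _ ->] x y eq_xy | closedS].
  rewrite !in_bigcup_seq => /hasP[d ds_d]; rewrite inE => /forallP xd.
  by apply/hasP; exists d; rewrite // inE; apply/forallP => i; rewrite -eq_xy.
pose gcds (x : Gamma m) := [ffun i => gcdn (x i) (m i)].
exists [seq gcds x | x <- enum S].
  apply/allP => _ /mapP[x _ ->]; apply/forallP => i.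
  by rewrite ffunE gcdn_gt0 m_gt0 orbT dvdn_gcdr.
apply/setP => y; rewrite big_map in_bigcup_seq.
apply/idP/hasP => [yS | [x]].
  by exists y; rewrite ?mem_enum // inE; apply/forallP => i; rewrite ffunE.
rewrite mem_enum inE => xS /forallP eq_yx; apply: closedS xS => i.
by rewrite (eqP (eq_yx i)) ffunE.
Qed.

(** The multipliers are natural numbers rather than residues because the group
    'I_1 of a factor m_i = 1 has no ring structure; iterated addition makes
    additivity immediate in all cases. *)
Definition coord_mul (u : 'I_r -> nat) (x : Gamma m) : Gamma m :=
  [ffun i => x i *+ u i].

Lemma coord_mul0 u : coord_mul u 0 = 0.
Proof. by apply/ffunP => i; rewrite !ffunE mul0rn. Qed.

Lemma coord_mulB u x y : coord_mul u (x - y) = coord_mul u x - coord_mul u y.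
Proof. by apply/ffunP => i; rewrite !ffunE mulrnBl. Qed.

Lemma val_coord_mul u x i : coord_mul u x i = (x i * u i %% m i)%N :> nat.
Proof. by rewrite ffunE Zp_mulrn; congr (_ %% _)%N; apply: prednK. Qed.

Lemma coord_mul_same_gcd u x :
  (forall i, coprime (u i) (m i)) -> same_gcd x (coord_mul u x).
Proof.
move=> co_u i; rewrite val_coord_mul gcdn_modl ![gcdn _ (m i)]gcdnC.
by rewrite Gauss_gcdl // coprime_sym.
Qed.

Lemma same_gcd_coord_mul x y : same_gcd x y ->
  exists2 u, forall i, coprime (u i) (m i) & y = coord_mul u x.
Proof.
move=> eq_xy; have /fin_all_exists[u uP] i : exists k,
    coprime k (m i) /\ (x i * k = y i %[mod m i])%N.
  by have [k] := coprime_multiplier (m_gt0 i) (eq_xy i); exists k.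
exists u => [i|]; first by have [] := uP i.
apply/ffunP => i; apply: val_inj; have [_ eq_i] := uP i.
rewrite /= val_coord_mul eq_i modn_small //.
by rewrite -[X in (_ < X)%N](prednK (m_gt0 i)) ltn_ord.
Qed.

(** A multiplication by units taking x to y is a graph endomorphism fixing 0, so
    it carries walks from x to 0 to walks from y to 0; the walks in the other
    direction come from a second multiplication, taking y to x. *)
Lemma dist_same_gcd (S : {set Gamma m}) (gS : gcd_set S) x y :
  same_gcd x y -> dist (Cay (gcd_setN gS)) x 0 = dist (Cay (gcd_setN gS)) y 0.
Proof.
have walk_sub n z t : same_gcd z t ->
    walk (Cay (gcd_setN gS)) n z 0 -> walk (Cay (gcd_setN gS)) n t 0.
  move=> /same_gcd_coord_mul[u co_u ->]; rewrite -{2}(coord_mul0 u).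
  apply: walk_homo => a b /=; rewrite -coord_mulB.
  by apply/((gcd_setP S).1 gS)/coord_mul_same_gcd.
move=> eq_xy; apply: eq_dist => n; apply/idP/idP; exact: walk_sub.
Qed.

End GcdSets.

Local Close Scope ring_scope.

Theorem theorem5 (r : nat) (m : 'I_r -> nat)
    (m_gt0 : forall i : 'I_r, (0 < m i)%N)
    (G : ugraph (Gamma m)) (gG : gcd_graph G) (D : set (option nat)) :
  gcd_graph (distance_power G D).
Proof.
have [S [gS eqG]] := gG.
pose S' := [set x : Gamma m | dist (Cay (gcd_setN gS)) x 0%R \in D].
have gS' : gcd_set S'.
  apply/(gcd_setP m_gt0) => x y eq_xy; rewrite !inE.
  by rewrite (dist_same_gcd m_gt0 gS eq_xy).
exists S', gS' => x y; rewrite /= [RHS]inE -dist_Cay_sub.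
congr (_ \in D); apply: eq_dist => n; apply: eq_existsb => p.
by rewrite (eq_path eqG).
Qed.
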